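(* Let $X_1$ and $X_2$ be two fuzzy incidence graphs with effective pairs (i.e. all of whose pairs are effective). Then the tensor product $X_1\diamond X_2$ is a fuzzy incidence graph with effective pairs.
   Context: Fuzzy incidence graphs. All graphs are finite, simple and undirected; $\wedge$ denotes minimum. A fuzzy incidence graph (FIG) $X=(V,E,I,\varepsilon,\rho,\eta)$ consists of a nonempty finite vertex set $V$, a set $E$ of edges $xy=yx$ ($x\neq y$ in $V$), a set $I$ of (incidence) pairs $(x,xy)$ with $xy\in E$ and $x$ an endpoint of $xy$, and functions $\varepsilon:V\to(0,1]$, $\rho:E\to(0,1]$, $\eta:I\to(0,1]$ with $\rho(xy)\le\varepsilon(x)\wedge\varepsilon(y)$ for all $xy\in E$ and $\eta(x,xy)\le\varepsilon(x)\wedge\rho(xy)$ for all $(x,xy)\in I$ (vertices, edges, pairs of weight $0$ are regarded as absent). A pair $(x,xy)\in I$ is effective if $\eta(x,xy)=\varepsilon(x)\wedge\rho(xy)$. Tensor product. For FIGs $X_i=(V_i,E_i,I_i,\varepsilon_i,\rho_i,\eta_i)$, $i=1,2$, the tensor product $X_1\diamond X_2=(V,E,I,\varepsilon,\rho,\eta)$ has $V=V_1\times V_2$; $E=\{(a_1,b_1)(a_2,b_2): a_1a_2\in E_1\text{ and }b_1b_2\in E_2\}$; $I$ is the set of pairs $((a_1,b_1),(a_1,b_1)(a_2,b_2))$ with $(a_1,a_1a_2),(a_2,a_1a_2)\in I_1$ and $(b_1,b_1b_2),(b_2,b_1b_2)\in I_2$; $\varepsilon(a,b)=\varepsilon_1(a)\wedge\varepsilon_2(b)$;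 $\rho((a_1,b_1)(a_2,b_2))=\rho_1(a_1a_2)\wedge\rho_2(b_1b_2)$; $\eta((a_1,b_1),(a_1,b_1)(a_2,b_2))=\eta_1(a_1,a_1a_2)\wedge\eta_2(b_1,b_1b_2)$. *)

(* Defs.v *)
From HB Require Import structures.
From mathcomp Require Import all_boot all_order all_algebra.
From mathcomp Require Import reals.
Set Implicit Arguments.
Unset Strict Implicit.
Unset Printing Implicit Defensive.
Import Order.TTheory GRing.Theory Num.Theory.
Local Open Scope ring_scope.

(* The raw data (V, E, I, eps, rho, eta).  An edge xy is given by its endpoints,
   so [edge] and [rho] have to be symmetric (imposed in [is_FIG]).  The pair
   (x, xy) is determined by the ordered pair (x, y): [inc x y] means that
   (x, xy) is in I and [eta x y] is eta(x, xy).  The values of [rho] outside E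
   and of [eta] outside I are irrelevant. *)
Record FIG_data (R : realType) (V : finType) := FIGData {
  edge : rel V;
  inc : rel V;
  eps : V -> R;
  rho : V -> V -> R;
  eta : V -> V -> R
}.

Record is_FIG (R : realType) (V : finType) (X : FIG_data R V) : Prop := IsFIG {
  FIG_nonempty : (0 < #|V|)%N;
  FIG_edge_sym : symmetric (edge X);
  FIG_edge_irr : irreflexive (edge X);
  FIG_inc_edge : forall x y, inc X x y -> edge X x y;
  FIG_rho_sym : forall x y, edge X x y -> rho X x y = rho X y x;
  FIG_eps_range : forall x, 0 < eps X x <= 1;
  FIG_rho_range : forall x y, edge X x y -> 0 < rho X x y <= 1;
  FIG_eta_range : forall x y, inc X x y -> 0 < eta X x y <= 1;
  FIG_rho_le : forall x y,
    edge X x y -> rho X x y <= Num.min (eps X x) (eps X y);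
  FIG_eta_le : forall x y,
    inc X x y -> eta X x y <= Num.min (eps X x) (rho X x y)
}.

Definition effective_pair (R : realType) (V : finType) (X : FIG_data R V)
    (x y : V) : Prop :=
  inc X x y /\ eta X x y = Num.min (eps X x) (rho X x y).

Definition FIG_with_effective_pairs (R : realType) (V : finType)
    (X : FIG_data R V) : Prop :=
  is_FIG X /\ forall x y : V, inc X x y -> effective_pair X x y.

Definition tensor (R : realType) (V1 V2 : finType)
    (X1 : FIG_data R V1) (X2 : FIG_data R V2) : FIG_data R (V1 * V2)%type :=
  {| edge := fun p q => edge X1 p.1 q.1 && edge X2 p.2 q.2;
     inc := fun p q => [&& inc X1 p.1 q.1, inc X1 q.1 p.1,
                           inc X2 p.2 q.2 & inc X2 q.2 p.2];
     eps := fun p => Num.min (eps X1 p.1) (eps X2 p.2);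
     rho := fun p q => Num.min (rho X1 p.1 q.1) (rho X2 p.2 q.2);
     eta := fun p q => Num.min (eta X1 p.1 q.1) (eta X2 p.2 q.2) |}.

(* Main.v *)
Require Import Defs.
From HB Require Import structures.
From mathcomp Require Import all_boot all_order all_algebra.
From mathcomp Require Import reals.
Import Order.TTheory.

(** Every weight of the product is a minimum of weights of the factors, so everything rests on the
    interchange law [minACA]: $(a\wedge b)\wedge(c\wedge d)=(a\wedge c)\wedge(b\wedge d)$. It turns
    a bound by minima in the product into the minimum of the two factor bounds; equality in both
    factors then gives equality in the product. *)

(** Serves the range conditions of all three weights [eps], [rho] and [eta]. *)
Lemma min_in_unit (R : realType) (a b : R) :
  (0 < a <= 1 -> 0 < b <= 1 -> 0 < Num.min a b <= 1)%R.
Proof.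
by move=> /andP[a0 a1] /andP[b0 _]; rewrite lt_min a0 b0 /= ge_min a1.
Qed.

Lemma tensor_is_FIG (R : realType) (V1 V2 : finType)
    (X1 : FIG_data R V1) (X2 : FIG_data R V2) :
  is_FIG X1 -> is_FIG X2 -> is_FIG (tensor X1 X2).
Proof.
case=> n1 es1 ei1 ie1 rs1 ep1 rr1 er1 rl1 el1.
case=> n2 es2 ei2 ie2 rs2 ep2 rr2 er2 rl2 el2.
split=> /=.
- by rewrite card_prod muln_gt0 n1.
- by move=> p q /=; rewrite es1 es2.
- by move=> p /=; rewrite ei1.
- by move=> p q /and4P[i1 _ i2 _]; rewrite ie1 ?ie2.
- by move=> p q /andP[e1 e2]; rewrite rs1 // rs2.
- by move=> p; apply: min_in_unit.
- by move=> p q /andP[e1 e2]; apply: min_in_unit; [apply: rr1 | apply: rr2].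
- by move=> p q /and4P[i1 _ i2 _]; apply: min_in_unit; [apply: er1 | apply: er2].
(* Regrouping the right-hand side by factor reduces the bound to monotonicity of the minimum; the
   bound on [eta] goes the same way. *)
- by move=> p q /andP[e1 e2]; rewrite minACA le_min2 ?rl1 ?rl2.
- by move=> p q /and4P[i1 _ i2 _]; rewrite minACA le_min2 ?el1 ?el2.
Qed.

Theorem theorem5p2 (R : realType) (V1 V2 : finType)
    (X1 : FIG_data R V1) (X2 : FIG_data R V2)
    (hX1 : FIG_with_effective_pairs X1)
    (hX2 : FIG_with_effective_pairs X2) :
  FIG_with_effective_pairs (tensor X1 X2).
Proof.
case: hX1 hX2 => [F1 eff1] [F2 eff2]; split; first exact: tensor_is_FIG.
move=> p q ipq; split=> //=.
(* Effectiveness in each factor replaces [eta] by its minimum, so that only the interchange of the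
   four weights remains. *)
have /and4P[/eff1[_ ->] _ /eff2[_ ->] _] := ipq.
exact: minACA.
Qed.
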